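(* Let $m\ge 2$, $n\ge m$ and $B\ge 1$ be integers, let $X_1,\ldots,X_n$ be i.i.d. random variables with values in a measurable space $\mathcal{X}$, and let $h:\mathcal{X}^m\to\mathbb{R}$ be measurable with $m_h=\mathrm{E}\,h(X_1,\ldots,X_m)$. Let $\widetilde U_B(h)$ be the incomplete U-statistic with $B$ terms. Suppose $h$ takes values in an interval of length $R$, and let $k=\lfloor n/m\rfloor$. For every $\delta\in(0,1)$, with probability at least $1-\delta$, $$|\widetilde U_B(h)-m_h|\le R\sqrt{\frac{\log(4/\delta)}{2k}}+R\sqrt{\frac{\log(4/\delta)}{2B}}.$$
   Context: Let $I_n^{m,<}$ denote the set of increasing $m$-tuples from $\{1,\ldots,n\}$. Draw $I_1,\ldots,I_B$ uniformly at random from $I_n^{m,<}$, with replacement (so $I_1,\ldots,I_B$ are i.i.d. uniform) and independently of the data $X_1,\ldots,X_n$. The incomplete U-statistic with $B$ terms is $$\widetilde U_B(h)=\frac1B\sum_{b=1}^B h(X_{I_b}),$$ where for $I=(i_1,\ldots,i_m)$ with $i_1<\cdots<i_m$, $h(X_I)=h(X_{i_1},\ldots,X_{i_m})$. Probability is with respect to the joint randomness of the data and the tuples. *)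

(* Defs.v *)
From HB Require Import structures.
From mathcomp Require Import all_boot all_order all_algebra.
From mathcomp Require Import all_classical all_reals all_analysis.

Set Implicit Arguments.
Unset Strict Implicit.
Unset Printing Implicit Defensive.

Import Order.TTheory GRing.Theory Num.Theory.
Import numFieldNormedType.Exports.

Local Open Scope classical_set_scope.
Local Open Scope ring_scope.

(* Increasing m-tuples of indices, {1, ..., n} being represented by 'I_n.
   The otherwise unused proof of m <= n makes the type inhabited, which a
   measurableType is required to be. *)
Record inc_tuple (n m : nat) (hmn : (m <= n)%N) := IncTuple {
  tuple_of_inc :> m.-tuple 'I_n ;
  inc_tupleP : sorted ltn (map val tuple_of_inc) }.

Section inc_tuple_instances.
Context (n m : nat) (hmn : (m <= n)%N).

HB.instance Definition _ := [isSub for @tuple_of_inc n m hmn].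
HB.instance Definition _ := [Finite of inc_tuple hmn by <:].

Definition first_indices : m.-tuple 'I_n := [tuple widen_ord hmn j | j < m].

Lemma first_indicesP : sorted ltn (map val first_indices).
Proof.
suff -> : map val first_indices = iota 0 m by exact: iota_ltn_sorted.
by rewrite /= -map_comp -val_enum_ord.
Qed.

HB.instance Definition _ :=
  isPointed.Build (inc_tuple hmn) (IncTuple hmn first_indicesP).

HB.instance Definition _ := @isMeasurable.Build default_measure_display
  (inc_tuple hmn) discrete_measurable discrete_measurable0
  discrete_measurableC discrete_measurableU.

End inc_tuple_instances.

Section independence.
Context d (T : measurableType d) (R : realType) (P : probability T R).

Definition mutually_independent d' (E : measurableType d') (I : finType)
    (X : I -> {RV P >-> E}) : Prop :=
  forall (J : {set I}) (A : I -> set E),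
    (forall i, i \in J -> measurable (A i)) ->
    P (\bigcap_(i in [set` J]) X i @^-1` A i) =
    (\prod_(i in J) P (X i @^-1` A i))%E.

(* Only measurable sets are compared: the value of a measure on other sets is
   meaningless. *)
Definition identically_distributed d' (E : measurableType d') (I : Type)
    (X : I -> {RV P >-> E}) : Prop :=
  forall (i j : I) (A : set E), measurable A ->
    distribution P (X i) A = distribution P (X j) A.

Definition iid d' (E : measurableType d') (I : finType)
    (X : I -> {RV P >-> E}) : Prop :=
  mutually_independent X /\ identically_distributed X.

(* Independence of the sigma-algebras generated by the two families. *)
Definition independent_families d1 (E1 : measurableType d1) d2
    (E2 : measurableType d2) (n1 n2 : nat)
    (X : 'I_n1 -> {RV P >-> E1}) (Y : 'I_n2 -> {RV P >-> E2}) : Prop :=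
  forall A C : set T,
    g_sigma_preimage (fun i => X i : T -> E1) A ->
    g_sigma_preimage (fun j => Y j : T -> E2) C ->
    P (A `&` C) = (P A * P C)%E.

Definition uniformly_distributed n m (hmn : (m <= n)%N)
    (Y : {RV P >-> inc_tuple hmn}) : Prop :=
  forall t : inc_tuple hmn,
    distribution P Y [set t] = (#|{: inc_tuple hmn}|%:R^-1)%:E.

End independence.

Section incomplete_U_statistic.
Context d (T : measurableType d) (R : realType) (P : probability T R).
Context d' (E : measurableType d') (n m : nat) (hmn : (m <= n)%N).
Variables (h : m.-tuple E -> R) (X : 'I_n -> {RV P >-> E}).

Definition subsample (t : m.-tuple 'I_n) (w : T) : m.-tuple E :=
  [tuple X (tnth t j) w | j < m].

Definition kernel_mean : R :=
  fine ('E_P[fun w => h (subsample (first_indices hmn) w)])%E.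

Definition incomplete_U_statistic (B : nat) (I : 'I_B -> {RV P >-> inc_tuple hmn})
    (w : T) : R :=
  B%:R^-1 * \sum_(b < B) h (subsample (I b w) w).

End incomplete_U_statistic.

(* Main.v *)
From HB Require Import structures.
Require Import Defs.
From mathcomp Require Import all_boot all_order all_algebra.
From mathcomp Require Import all_classical all_reals all_analysis.
From mathcomp Require Import fingroup perm action alt primitive_action.
From mathcomp Require Import measurable_realfun numfun ring lra.

(** The error splits as U_B - E h = (U_B - U) + (U - E h), where U is the average
of h over all increasing tuples of indices (the complete U-statistic, defined as
[complete_U_statistic]). Each summand is shown to be sub-Gaussian, with
E exp(s Z) <= exp(s^2 r^2 / (8 N)) for N = B and N = k respectively; Chernoff's
bound then gives each of them the tail probability 2 exp(-L) = delta / 2 at the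
threshold r sqrt(L / (2 N)), L = ln (4 / delta), and a union bound concludes.

- For U - E h, Hoeffding's averaging device is used. For a permutation p of
  the indices, cut p(0), ..., p(k m - 1) into k blocks of m indices, sort each
  block, and average h over the k blocks. The average of these block averages
  over all p is U ([sum_perm_inc]: permutations act transitively on increasing
  tuples); the sorting matters, as U only sees increasing tuples and h may
  depend on the order of its arguments. By convexity of exp, the moment
  generating function of U - E h is at most the mean of those of the block
  averages. Since the blocks are disjoint, each of the latter is a product of
  k moment generating functions of h(X_1, ..., X_m) - E h
  ([ge0_expectation_prod_blocks]), and Hoeffding's lemma bounds every factor
  ([mgf_complete_U_statistic]).

- For U_B - U, conditionally on the data U_B is a mean of B independent uniform
  draws from the finite population of the values h(X_t), of mean U. The
  conditioning is made explicit by summing over the finitely many values of the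
  drawn tuples, the event of each value being independent of the data
  ([expectation_on_indices]). Hoeffding's lemma for a finite population then
  applies pointwise in the data ([mgf_incomplete_U_statistic]).

Both versions of Hoeffding's lemma come from one pointwise inequality,
[expR_le_affine]: an affine bound of exp on the interval, which can be integrated
against any probability whose mean is the point mu. *)

Set Implicit Arguments.
Unset Strict Implicit.
Unset Printing Implicit Defensive.

Import Order.TTheory GRing.Theory Num.Theory.
Import numFieldNormedType.Exports.

Local Open Scope classical_set_scope.
Local Open Scope ring_scope.

(** * Exponential and product inequalities *)

Section real_inequalities.
Context {R : realType}.
Implicit Types p u s r a x mu : R.

Lemma derive_le0_le_at0 (f df : R -> R) (u : R) :
  (forall x, is_derive x 1 f (df x)) -> (forall x, 0 <= x -> df x <= 0) ->
  0 <= u -> f u <= f 0.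
Proof.
move=> fdf df0 u0.
have fc : {within `[0, u], continuous f}.
  by apply: derivable_within_continuous => x _; case: (fdf x).
apply: (@ler0_derive1_le_cc _ f 0 u) => //.
- move=> x; rewrite in_itv/= => /andP[x0 _].
  by rewrite derive1E (@derive_val _ _ _ _ _ _ _ (fdf x)) df0// ltW.
- by rewrite in_itv/= u0 lexx.
- by rewrite in_itv/= lexx u0.
Qed.

(** This is Hoeffding's lemma for a Bernoulli variable of parameter p, uncentred.
With N(u) = 1 - p + p e^u, the logarithm of the ratio of the two sides vanishes at
0 together with its derivative g(u) = q - p - u / 4, where q = p e^u / N(u), and
g' = q (1 - q) - 1/4 <= 0. The ratio itself is differentiated instead of its
logarithm: its derivative is the ratio times g. *)
Lemma bernoulli_mgf_le p u : 0 <= p <= 1 ->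
  1 - p + p * expR u <= expR (p * u + u ^+ 2 / 8).
Proof.
move=> /andP[].
(* exchanging the two outcomes replaces (p, u) by (1 - p, -u) *)
wlog u0 : p u / 0 <= u => [hwlog p0 p1|p0 p1].
  have [/hwlog|u0] := leP 0 u; first exact.
  have := hwlog (1 - p) (- u); rewrite oppr_ge0 (ltW u0) => /(_ erefl).
  rewrite subr_ge0 gerBl => /(_ p1 p0).
  rewrite -(ler_pM2l (expR_gt0 u)) -expRD mulrDr mulrCA -expRD subrr expR0 => H.
  have -> : 1 - p + p * expR u = expR u * (1 - (1 - p)) + (1 - p) * 1 by ring.
  by apply: (le_trans H); rewrite ler_expR; lra.
pose N x := 1 - p + p * expR x.
have N0 x : 0 < N x.
  have := expR_gt0 x; rewrite /N; nra.
have dN x : is_derive x 1 N (p * expR x).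
  by rewrite /N; apply: is_derive_eq; rewrite /GRing.scale /=; ring.
pose g x := p * expR x / N x - p - x / 4.
pose dg x := p * expR x * (1 - p) / N x ^+ 2 - 4^-1.
have gdg x : is_derive x 1 g (dg x).
  have Nx0 := lt0r_neq0 (N0 x).
  have dV := is_deriveV Nx0 (dN x).
  rewrite /g; apply: is_derive_eq.
  rewrite /dg /GRing.scale/= /N; field.
  by rewrite -/(N x).
have dg0 x : 0 <= x -> dg x <= 0.
  move=> x0; rewrite /dg subr_le0 ler_pdivrMr ?exprn_gt0// /N.
  have := sqr_ge0 (1 - p - p * expR x); nra.
have g0 x : 0 <= x -> g x <= 0.
  move=> x0; have := derive_le0_le_at0 gdg dg0 x0.
  suff -> : g 0 = 0 by [].
  by rewrite /g /N expR0 !mulr1 subrK divr1 subrr mul0r subrr.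
pose f x := N x * expR (- (p * x + x ^+ 2 / 8)).
have fdf x : is_derive x 1 f (f x * g x).
  have dE : is_derive x 1 (fun x => expR (- (p * x + x ^+ 2 / 8)))
     (expR (- (p * x + x ^+ 2 / 8)) * (- (p + x / 4))).
    apply: (is_derive1_comp (f := expR) (g := fun x => - (p * x + x ^+ 2 / 8))).
    by apply: is_derive_eq; rewrite /GRing.scale /=; field.
  rewrite /f; apply: is_derive_eq.
  rewrite /f /g /GRing.scale /=; field.
  exact: lt0r_neq0.
have f1 : f u <= f 0.
  apply: (derive_le0_le_at0 fdf) => // x x0.
  by rewrite mulr_ge0_le0 ?g0// /f mulr_ge0 ?expR_ge0// ltW.
move: f1; rewrite /f [N 0]/N expR0 expRN ler_pdivrMr ?expR_gt0//.
by rewrite expr0n/= mulr0 mul0r addr0 oppr0 expR0 !mulr1 subrK mul1r.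
Qed.

(** By convexity exp lies below its chord over [a, a + r], and the value of the
chord at mu is the moment generating function of a centred two-point variable
with values a and a + r. The term in b vanishes as soon as x is averaged with
mean mu, whatever the averaging probability is. *)
Lemma expR_le_affine a r mu s : mu \in `[a, a + r] ->
  exists b : R, forall x, x \in `[a, a + r] ->
    expR (s * (x - mu)) <= expR (s ^+ 2 * r ^+ 2 / 8) + b * (x - mu).
Proof.
rewrite in_itv/= => /andP[amu mur].
have [r0|r0] := leP r 0.
  exists 0 => x; rewrite in_itv/= => /andP[ax xr].
  have -> : x = mu by lra.
  by rewrite subrr !mulr0 addr0 ler_expR; have := sqr_ge0 (s * r); lra.
pose p := (mu - a) / r.
have p01 : 0 <= p <= 1.
  by rewrite /p divr_ge0 ?ler_pdivrMr//; lra.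
have rp : p * r = mu - a by rewrite /p divfK// gt_eqF.
pose ea := expR (s * (a - mu)); pose eb := expR (s * (a + r - mu)).
have chord_mu : (1 - p) * ea + p * eb <= expR (s ^+ 2 * r ^+ 2 / 8).
  have := bernoulli_mgf_le (s * r) p01.
  rewrite -(ler_pM2l (expR_gt0 (s * (a - mu)))) -expRD mulrDr mulrCA -expRD.
  have -> : s * (a - mu) + s * r = s * (a + r - mu) by ring.
  have -> : s * (a - mu) + (p * (s * r) + (s * r) ^+ 2 / 8) =
            s ^+ 2 * r ^+ 2 / 8.
    have -> : a - mu = - (p * r) by rewrite rp; ring.
    by field.
  by rewrite mulrC.
exists ((eb - ea) / r) => x; rewrite in_itv/= => /andP[ax xr].
pose q := (x - a) / r.
have q01 : 0 <= q <= 1.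
  by rewrite /q divr_ge0 ?ler_pdivrMr//; lra.
have rq : q * r = x - a by rewrite /q divfK// gt_eqF.
have chord_x : expR (s * (x - mu)) <= (1 - q) * ea + q * eb.
  have /andP[q0 q1] := q01.
  have := @convex_expR R (Itv01 q0 q1) (s * (a + r - mu)) (s * (a - mu)).
  rewrite !convRE /= -/ea -/eb => H.
  rewrite [leRHS]addrC; apply: le_trans H; rewrite ler_expR.
  have -> : x = a + q * r by rewrite rq; ring.
  by rewrite /unstable.onem; lra.
apply: (le_trans chord_x).
have -> : (1 - q) * ea + q * eb =
    (1 - p) * ea + p * eb + (eb - ea) / r * (x - mu).
  have -> : x = a + q * r by rewrite rq; ring.
  have -> : mu = a + p * r by rewrite rp; ring.
  by field; rewrite gt_eqF.
by rewrite lerD2r.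
Qed.

(** Jensen's inequality, from the tangent of exp at the mean. *)
Lemma expR_mean_le (J : finType) (x : J -> R) : (0 < #|J|)%N ->
  expR (#|J|%:R^-1 * \sum_j x j) <= #|J|%:R^-1 * \sum_j expR (x j).
Proof.
move=> J0; set mu := _ * \sum_j x j.
have J0' : #|J|%:R != 0 :> R by rewrite pnatr_eq0 -lt0n.
have -> : expR mu = #|J|%:R^-1 * \sum_j expR mu * (1 + (x j - mu)).
  rewrite -mulr_sumr big_split/= sumrB !sumr_const.
  rewrite (_ : \sum_j x j = mu * #|J|%:R); last by rewrite /mu mulrC mulVKf.
  by rewrite mulr_natr subrr addr0 mulrCA mulVf ?mulr1.
rewrite ler_pM2l ?invr_gt0 ?ltr0n//; apply: ler_sum => j _.
rewrite -[X in _ <= X](_ : expR mu * expR (x j - mu) = _).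
  by rewrite ler_pM2l ?expR_gt0// expR_ge1Dx.
by rewrite -expRD addrCA subrr addr0.
Qed.

(** Hoeffding's lemma for a uniform draw from a finite population. *)
Lemma mean_expR_le (J : finType) (x : J -> R) a r s : (0 < #|J|)%N ->
  (forall j, x j \in `[a, a + r]) ->
  #|J|%:R^-1 * \sum_j expR (s * (x j - #|J|%:R^-1 * \sum_j x j)) <=
    expR (s ^+ 2 * r ^+ 2 / 8).
Proof.
move=> J0 xar; set mu := _ * \sum_j x j.
have J0' : 0 < #|J|%:R :> R by rewrite ltr0n.
have muJ : mu * #|J|%:R = \sum_j x j by rewrite /mu mulrC mulVKf// gt_eqF.
have muar : mu \in `[a, a + r].
  rewrite in_itv/= -(ler_pM2r J0') -[X in _ && X](ler_pM2r J0') muJ.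
  rewrite !mulr_natr -!sumr_const; apply/andP; split; apply: ler_sum => j _;
    by have := xar j; rewrite in_itv/= => /andP[].
have [b hb] := expR_le_affine s muar.
rewrite mulrC ler_pdivrMr//.
apply: (le_trans (ler_sum _ (fun j _ => hb _ (xar j)))).
rewrite big_split/= -mulr_sumr sumrB !sumr_const -[mu *+ _]mulr_natr muJ.
by rewrite subrr mulr0 addr0 mulr_natr.
Qed.

Lemma expR_mean_prod (J : finType) (x : J -> R) s mu : (0 < #|J|)%N ->
  expR (s * (#|J|%:R^-1 * \sum_j x j - mu)) =
  \prod_j expR (s / #|J|%:R * (x j - mu)).
Proof.
move=> J0; have J0' : #|J|%:R != 0 :> R by rewrite pnatr_eq0 -lt0n.
rewrite -expR_sum -mulr_sumr sumrB sumr_const -[mu *+ _]mulr_natr.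
by congr expR; field.
Qed.

(** Averaging N independent copies divides the variance proxy by N. *)
Lemma expR_sqr_expn (N : nat) s r : (0 < N)%N ->
  expR ((s / N%:R) ^+ 2 * r ^+ 2 / 8) ^+ N =
  expR (s ^+ 2 * (r ^+ 2 / (8 * N%:R))).
Proof.
move=> N0; have N0' : N%:R != 0 :> R by rewrite pnatr_eq0 -lt0n.
by rewrite -expRM_natl; congr expR; field.
Qed.

End real_inequalities.

Lemma lee_prod (R : realDomainType) (J : finType) (f g : J -> \bar R) :
  (forall j, 0 <= f j <= g j)%E -> (\prod_j f j <= \prod_j g j)%E.
Proof.
move=> fg; suff /andP[] : (0 <= \prod_j f j <= \prod_j g j)%E by [].
elim/big_rec2 : _ => [|j y1 y2 _ /andP[y10 y12]]; first by rewrite lee01 lexx.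
have /andP[f0 fgj] := fg j.
by rewrite mule_ge0//= lee_pmul.
Qed.

(** * Sub-Gaussian random variables *)

Section moment_generating_function.
Context d (T : measurableType d) (R : realType) (P : probability T R).

Lemma bounded_RV_integrable (Z : {RV P >-> R}) (a b : R) :
  (forall w, Z w \in `[a, b]) -> P.-integrable [set: T] (EFin \o Z).
Proof.
move=> Zab; apply: measurable_bounded_integrable => //.
  by rewrite (le_lt_trans (probability_le1 _ _)) ?ltry.
exists (`|a| + `|b|); split; first exact: num_real.
move=> M abM w _ /=; apply: le_trans (ltW abM).
have := Zab w; rewrite in_itv/= => /andP[aZ Zb].
rewrite ler_norml; apply/andP; split.
  by apply: le_trans aZ; have := ler_norm (- a); have := normr_ge0 b;
     rewrite normrN; lra.
by apply: (le_trans Zb); have := ler_norm b; have := normr_ge0 a; lra.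
Qed.

Lemma hoeffding_lemma (Z : {RV P >-> R}) (a r s : R) :
  (forall w, Z w \in `[a, a + r]) ->
  ('M_P (fun w => Z w - fine 'E_P[Z])%R s <= (expR (s ^+ 2 * r ^+ 2 / 8))%:E)%E.
Proof.
move=> Zar; have iZ := bounded_RV_integrable Zar.
have mZ : measurable_fun [set: T] (Z : T -> R) by [].
pose mu := fine 'E_P[Z].
have muE : (\int[P]_w (Z w)%:E = mu%:E)%E.
  by rewrite /mu unlock fineK//; exact: integrable_fin_num.
have int_cst (c : R) : (\int[P]_w c%:E = c%:E)%E.
  rewrite integral_cst//; have := probability_setT P => /= ->.
  by rewrite mule1.
have icst (c : R) : P.-integrable [set: T] (fun=> c%:E).
  by apply: finite_measure_integrable_cst.
have muar : mu \in `[a, a + r].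
  rewrite in_itv/=; apply/andP; split; rewrite -lee_fin -muE -int_cst.
    apply: le_integral => //.
    by move=> w _ /=; rewrite lee_fin; have := Zar w; rewrite in_itv/= => /andP[].
  apply: le_integral => //.
  by move=> w _ /=; rewrite lee_fin; have := Zar w; rewrite in_itv/= => /andP[].
have [b hb] := expR_le_affine s muar.
rewrite /mmt_gen_fun -/mu unlock; set K := expR _.
have -> : K%:E = (\int[P]_w (K - b * mu + b * Z w)%:E)%E.
  under eq_integral do rewrite EFinD EFinM.
  rewrite integralD//; last exact: integrableZl.
  rewrite integralZl// muE int_cst -EFinM -EFinD; congr EFin; ring.
apply: ge0_le_integral => //.
- by move=> w _; rewrite lee_fin expR_ge0.
- apply/measurable_EFinP; apply: measurableT_comp => //=.
  apply: measurable_funM => //; exact: measurable_funB.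
- by apply/measurable_EFinP; apply: measurable_funD => //; exact: measurable_funM.
- move=> w _ /=; rewrite lee_fin.
  by have := hb _ (Zar w); rewrite mulrC -/K; lra.
Qed.

(** Chernoff's bound for Z and - Z, at the optimal s = t / (2 v). *)
Lemma subgaussian_tail (Z : {RV P >-> R}) (v t : R) : 0 < v -> 0 < t ->
  (forall s, 'M_P Z s <= (expR (s ^+ 2 * v))%:E)%E ->
  (P [set w | t <= `|Z w|]%R <= (2 * expR (- (t ^+ 2 / (4 * v))))%:E)%E.
Proof.
move=> v0 t0 MZ; pose s := t / (2 * v).
have s0 : 0 < s by rewrite divr_gt0// mulr_gt0.
have expE : expR (s ^+ 2 * v) * expR (- (s * t)) = expR (- (t ^+ 2 / (4 * v))).
  by rewrite -expRD; congr expR; rewrite /s; field; rewrite gt_eqF.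
have one_side (Y : {RV P >-> R}) : ('M_P Y s <= (expR (s ^+ 2 * v))%:E)%E ->
    (P [set w | t <= Y w]%R <= (expR (- (t ^+ 2 / (4 * v))))%:E)%E.
  move=> MY; apply: (le_trans (chernoff Y t s0)).
  by rewrite -expE EFinM lee_wpmul2r// lee_fin expR_ge0.
pose NZ : {RV P >-> R} := (\- Z)%R.
have MNZ : ('M_P NZ s <= (expR (s ^+ 2 * v))%:E)%E.
  rewrite -sqrrN; apply: le_trans (MZ (- s)).
  rewrite /mmt_gen_fun le_eqVlt; apply/orP; left; apply/eqP.
  by congr ('E_P[_])%E; apply/funext => w /=; rewrite mulrN mulNr.
have -> : [set w | t <= `|Z w|]%R =
    [set w | t <= Z w]%R `|` [set w | t <= NZ w]%R.
  by apply/seteqP; split => w /=; rewrite ler_normr => /orP.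
have mle (Y : {RV P >-> R}) : measurable [set w | t <= Y w]%R.
  rewrite (_ : mkset _ = (Y : T -> R) @^-1` `[t, +oo[); last first.
    by apply/seteqP; split => w /=; rewrite in_itv/= andbT.
  exact: measurable_funPTI.
rewrite mulr_natl mulr2n EFinD.
apply: (@le_trans _ _ (P [set w | t <= Z w]%R + P [set w | t <= NZ w]%R)%E).
  exact: measureU2.
by apply: leeD; exact: one_side.
Qed.

Lemma ge0_expectation_mean (J : finType) (g : J -> T -> R) :
  (forall j, measurable_fun [set: T] (g j)) -> (forall j w, 0 <= g j w) ->
  (\int[P]_w (#|J|%:R^-1 * \sum_j g j w)%:E =
   \sum_j #|J|%:R^-1%:E * \int[P]_w (g j w)%:E)%E.
Proof.
move=> mg g0; have J0 : (0 <= #|J|%:R^-1 :> R) by rewrite invr_ge0.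
have mgE j : measurable_fun [set: T] (fun w => (g j w)%:E).
  exact/measurable_EFinP.
transitivity (\int[P]_w \sum_j (#|J|%:R^-1%:E * (g j w)%:E))%E.
  by apply: eq_integral => w _; rewrite mulr_sumr -sumEFin.
rewrite ge0_integral_sum//.
- apply: eq_bigr => j _; rewrite ge0_integralZl//.
  by move=> w _; rewrite lee_fin.
- by move=> j; apply: emeasurable_funM.
- by move=> j w _; rewrite mule_ge0// lee_fin.
Qed.

End moment_generating_function.

(** * Independence on tuples *)

Section tuple_boxes.
Context d (E : measurableType d) (p : nat).
Implicit Types A : 'I_p -> set E.

Definition box A : set (p.-tuple E) := [set y | forall i, A i (tnth y i)].

Lemma measurable_box A : (forall i, measurable (A i)) -> measurable (box A).
Proof.
move=> mA.
have -> : box A = \bigcap_(i in [set: 'I_p]) ((@tnth p E)^~ i @^-1` A i).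
  by apply/seteqP; split => y /= Ay i; [move=> _|]; apply: Ay.
apply: fin_bigcap_measurable => // i _.
by rewrite -[X in measurable X]setTI; apply: measurable_tnth.
Qed.

Lemma measurable_sub_box : @measurable _ (p.-tuple E) `<=`
  <<s [set box A | A in [set A | forall i, measurable (A i)]] >>.
Proof.
apply: smallest_sub; first exact: smallest_sigma_algebra.
rewrite -bigcup_seq; apply: bigcup_sub => i _ _ [C mC <-].
apply: sub_sigma_algebra; rewrite setTI.
exists (fun j => if j == i then C else setT) => [j|].
  by case: ifP.
apply/seteqP; split => y /= => [/(_ i)|Cy j]; first by rewrite eqxx.
by case: eqP => // ->.
Qed.

(** Boxes form a pi-system generating the product sigma-algebra. *)
Lemma box_measure_unique (R : realType)
    (mu nu : {measure set (p.-tuple E) -> \bar R}) :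
  (mu [set: p.-tuple E] < +oo)%E ->
  (forall A, (forall i, measurable (A i)) -> mu (box A) = nu (box A)) ->
  forall C, measurable C -> mu C = nu C.
Proof.
move=> muoo munu C /measurable_sub_box; move: C.
apply: (g_sigma_algebra_measure_unique _ _ (fun=> setT)) => //.
- by move=> _ [A mA <-]; exact: measurable_box.
- by move=> _; exists (fun=> setT) => //; apply/seteqP; split.
- by rewrite bigcup_const.
- move=> _ _ [A mA <-] [C mC <-]; exists (fun i => A i `&` C i) => [i|].
    exact: measurableI.
  apply/seteqP; split => y /=; last by move=> [Ay Cy] i; split.
  by move=> ACy; split => i; have [] := ACy i.
- by move=> _ [A mA <-]; exact: munu.
Qed.

Lemma measurable_nth (x0 : E) (j : nat) :
  measurable_fun [set: p.-tuple E] ((nth x0)^~ j \o val).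
Proof.
have [jp|pj] := ltnP j p.
  rewrite (_ : _ \o _ = (@tnth p E)^~ (Ordinal jp)); first exact: measurable_tnth.
  by apply/funext => y; rewrite /= (tnth_nth x0).
rewrite (_ : _ \o _ = cst x0); first exact: measurable_cst.
by apply/funext => y; rewrite /= nth_default// size_tuple.
Qed.

End tuple_boxes.

Section independence_expectation.
Context d (T : measurableType d) (R : realType) (P : probability T R).
Local Open Scope ereal_scope.

(** Both sides are finite measures in C, so it is enough to compare them on
boxes. *)
Lemma indep_of_boxes d' (E : measurableType d') p (D : set T)
    (V : {mfun T >-> p.-tuple E}) : measurable D ->
  (forall A : 'I_p -> set E, (forall i, measurable (A i)) ->
    P (D `&` V @^-1` box A) = P D * P (V @^-1` box A)) ->
  forall C, measurable C -> P (D `&` V @^-1` C) = P D * P (V @^-1` C).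
Proof.
move=> mD boxD C mC.
have PDE : P D = (fine (P D))%:E by rewrite fineK// fin_num_measure.
have PD0 : (0 <= fine (P D))%R by rewrite fine_ge0.
pose pushV : {measure set (p.-tuple E) -> \bar R} := pushforward (mrestr P mD) V.
pose mu := pushV (measurable_funPT V).
pose nu : {measure set (p.-tuple E) -> \bar R} :=
  mscale (NngNum PD0) (distribution P V).
have muE B : mu B = P (D `&` V @^-1` B).
  by rewrite /mu /= /pushforward /mrestr setIC.
have nuE B : nu B = P D * P (V @^-1` B) by rewrite /nu /= /mscale /= -PDE.
rewrite -muE -nuE; apply: box_measure_unique => //.
  rewrite muE preimage_setT setIT.
  by rewrite (le_lt_trans (probability_le1 _ _)) ?ltry.
by move=> A mA; rewrite muE nuE boxD.
Qed.

(** Independence says that the joint law of Y1 and Y2 is the product of their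
laws; Tonelli's theorem then separates the two factors. *)
Lemma ge0_expectation_prod d1 d2 (E1 : measurableType d1)
    (E2 : measurableType d2) (Y1 : {mfun T >-> E1}) (Y2 : {mfun T >-> E2})
    (f1 : E1 -> \bar R) (f2 : E2 -> \bar R) :
  (forall A C, measurable A -> measurable C ->
    P (Y1 @^-1` A `&` Y2 @^-1` C) = P (Y1 @^-1` A) * P (Y2 @^-1` C)) ->
  measurable_fun [set: E1] f1 -> (forall y, 0 <= f1 y) ->
  measurable_fun [set: E2] f2 -> (forall y, 0 <= f2 y) ->
  \int[P]_w (f1 (Y1 w) * f2 (Y2 w)) =
  \int[P]_w f1 (Y1 w) * \int[P]_w f2 (Y2 w).
Proof.
move=> Y12 mf1 f10 mf2 f20.
pose Y w := (Y1 w, Y2 w).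
have mY : measurable_fun [set: T] Y by exact: measurable_fun_pair.
pose YM : {mfun T >-> (E1 * E2)%type} :=
  HB.pack Y (isMeasurableFun.Build _ _ _ _ Y mY).
have prodE : forall C, measurable C ->
    (distribution P Y1 \x distribution P Y2) C = distribution P YM C.
  by apply: product_measure_unique => A C mA mC; rewrite -Y12.
pose f (y : E1 * E2) := f1 y.1 * f2 y.2.
have mf : measurable_fun [set: E1 * E2] f.
  by apply: emeasurable_funM; apply: measurableT_comp.
have f0 y : 0 <= f y by rewrite mule_ge0.
transitivity (\int[distribution P YM]_y f y).
  by rewrite ge0_integral_distribution.
transitivity (\int[distribution P Y1 \x distribution P Y2]_y f y).
  by apply: eq_measure_integral => C mC _; exact: (esym (prodE C mC)).
rewrite fubini_tonelli1// /fubini_F /f /=.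
under eq_integral do rewrite ge0_integralZl//.
rewrite ge0_integralZr//; last exact: integral_ge0.
by rewrite !ge0_integral_distribution.
Qed.

End independence_expectation.

Section subsamples.
Context d (T : measurableType d) (R : realType) (P : probability T R).
Context d' (E : measurableType d') (n : nat) (X : 'I_n -> {RV P >-> E}).
Local Open Scope ereal_scope.

Lemma measurable_subsample p (t : p.-tuple 'I_n) :
  measurable_fun [set: T] (subsample X t).
Proof.
apply/measurable_fun_tnthP => i.
rewrite (_ : _ \o _ = X (tnth t i))//.
by apply/funext => w; rewrite /= tnth_mktuple.
Qed.

HB.instance Definition _ p (t : p.-tuple 'I_n) :=
  isMeasurableFun.Build _ _ _ _ (subsample X t) (measurable_subsample t).

Lemma preimage_subsample_box p (t : p.-tuple 'I_n) (A : 'I_p -> set E) :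
  subsample X t @^-1` box A = [set w | forall i, A i (X (tnth t i) w)].
Proof.
apply/seteqP; split => w /= Aw i; have := Aw i; by rewrite tnth_mktuple.
Qed.

Hypothesis indX : mutually_independent X.

(** The events in the independence hypothesis are indexed by the variables
themselves; here by any injective choice of variables, so that it can be used for
the entries of a tuple, or of two tuples at once. *)
Lemma indep_reindex (K : finType) (c : K -> 'I_n) (A : K -> set E) :
  injective c -> (forall k, measurable (A k)) ->
  P [set w | forall k, A k (X (c k) w)] = \prod_(k : K) P (X (c k) @^-1` A k).
Proof.
move=> cI mA.
pose A' i := if [pick k | c k == i] is Some k then A k else setT.
have A'E k : A' (c k) = A k.
  rewrite /A'; case: pickP => [l /eqP/cI->//|/(_ k)].
  by rewrite eqxx.
have mA' i : measurable (A' i) by rewrite /A'; case: pickP.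
have := @indX [set c k | k in K]%SET A' (fun i _ => mA' i).
rewrite big_imset/=; last by move=> k l _ _ /cI.
rewrite [X in X = _ -> _](_ : _ = P [set w | forall k, A k (X (c k) w)]).
  by move=> ->; apply: eq_bigr => k _; rewrite A'E.
congr (P _); apply/seteqP; split => w /= Aw.
  by move=> k; rewrite -A'E; apply: Aw => /=; apply: imset_f.
by move=> i /= /imsetP[k _ ->]; rewrite A'E; exact: Aw.
Qed.

Lemma subsample_box p (t : p.-tuple 'I_n) (A : 'I_p -> set E) : uniq t ->
  (forall i, measurable (A i)) ->
  P (subsample X t @^-1` box A) = \prod_i P (X (tnth t i) @^-1` A i).
Proof.
move=> /tuple_uniqP tI mA; rewrite preimage_subsample_box.
exact: indep_reindex.
Qed.

(** Independence of the events is known on pairs of boxes; it is extended to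
measurable sets on one side, then on the other. *)
Lemma indep_subsamples p q (t : p.-tuple 'I_n) (u : q.-tuple 'I_n) :
  uniq (t ++ u) -> forall A C, measurable A -> measurable C ->
  P (subsample X t @^-1` A `&` subsample X u @^-1` C) =
  P (subsample X t @^-1` A) * P (subsample X u @^-1` C).
Proof.
rewrite cat_uniq => /and3P[ut /hasPn tu uu].
have boxes (A : 'I_p -> set E) (C : 'I_q -> set E) :
    (forall i, measurable (A i)) -> (forall i, measurable (C i)) ->
    P (subsample X t @^-1` box A `&` subsample X u @^-1` box C) =
    P (subsample X t @^-1` box A) * P (subsample X u @^-1` box C).
  move=> mA mC; rewrite !subsample_box//.
  pose c (k : 'I_p + 'I_q) :=
    match k with inl i => tnth t i | inr j => tnth u j end.
  pose AC (k : 'I_p + 'I_q) := match k with inl i => A i | inr j => C j end.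
  have cI : injective c.
    have tuN i j : tnth t i != tnth u j.
      by apply: contraNneq (tu _ (mem_tnth j u)) => <-; exact: mem_tnth.
    move=> [i|i] [j|j] //= eqij.
    - by congr inl; apply: (tuple_uniqP _ ut).
    - by have := tuN i j; rewrite eqij eqxx.
    - by have := tuN j i; rewrite eqij eqxx.
    - by congr inr; apply: (tuple_uniqP _ uu).
  have mAC k : measurable (AC k) by case: k.
  have := indep_reindex cI mAC; rewrite big_sumType/= => <-.
  congr (P _); rewrite !preimage_subsample_box.
  apply/seteqP; split => w /=; first by move=> [Aw Cw] [i|j] /=.
  by move=> ACw; split => i; [exact: (ACw (inl i))|exact: (ACw (inr i))].
move=> A C mA mC.
have mpre r (v : r.-tuple 'I_n) D : measurable D ->
  measurable (subsample X v @^-1` D) by move=> mD; exact: measurable_funPTI.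
apply: indep_of_boxes => // [|B mB]; first exact: mpre.
rewrite setIC muleC; apply: indep_of_boxes => //.
  by apply: mpre; exact: measurable_box.
by move=> F mF; rewrite setIC muleC boxes.
Qed.

(** By induction on the blocks: the block k is independent of the tuple of all the
variables outside of it, and the other factors are functions of that tuple. *)
Lemma ge0_expectation_prod_blocks (K : finType) p (c : K -> p.-tuple 'I_n)
    (f : K -> p.-tuple E -> R) :
  (forall k, uniq (c k)) ->
  (forall k l, k != l -> forall i, i \in c k -> i \notin c l) ->
  (forall k, measurable_fun [set: p.-tuple E] (f k)) ->
  (forall k y, (0 <= f k y)%R) ->
  \int[P]_w (\prod_k f k (subsample X (c k) w))%:E =
  \prod_k \int[P]_w (f k (subsample X (c k) w))%:E.
Proof.
move=> uc dc mf f0.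
have : uniq (index_enum K) by exact: index_enum_uniq.
elim: (index_enum K) => [_|k s IH /= /andP[ks us]].
  rewrite big_nil; under eq_integral do rewrite big_nil.
  by rewrite integral_cst// mul1e; exact: probability_setT.
rewrite big_cons -IH//; under eq_integral do rewrite big_cons EFinM.
(* g reads the entries of the block l at their positions in v; the default value
   of nth is never reached, as l is disjoint from k *)
pose v := in_tuple [seq i <- enum 'I_n | i \notin c k].
pose g (y : (size [seq i <- enum 'I_n | i \notin c k]).-tuple E) : R :=
  (\prod_(l <- s) f l [tuple nth point y (index (tnth (c l) i) v) | i < p])%R.
have gE w : (\prod_(l <- s) f l (subsample X (c l) w) = g (subsample X v w))%R.
  rewrite /g big_seq [RHS]big_seq; apply: eq_bigr => l ls; congr (f l _).
  apply: eq_from_tnth => i; rewrite !tnth_mktuple.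
  have lv : tnth (c l) i \in val v.
    rewrite mem_filter mem_enum andbT; apply: dc (mem_tnth i _).
    by apply: contraNneq ks => <-.
  have lt_iv : (index (tnth (c l) i) v < size (val v))%N by rewrite index_mem.
  rewrite -[index _ _]/(val (Ordinal lt_iv)) -tnth_nth tnth_mktuple.
  by congr (X _ w); rewrite (tnth_nth (tnth (c l) i) v) /= nth_index.
under eq_integral do rewrite gE; under [X in _ = _ * X]eq_integral do rewrite gE.
have mg : measurable_fun setT g.
  apply: measurable_prod => l _; apply: measurableT_comp => //.
  apply/measurable_fun_tnthP => i.
  rewrite (_ : _ \o _ = (nth point)^~ (index (tnth (c l) i) v) \o val).
    exact: measurable_nth.
  by apply/funext => y; rewrite /= tnth_mktuple.
apply: (@ge0_expectation_prod _ _ _ P _ _ _ _ (subsample X (c k))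
  (subsample X v) (EFin \o f k) (EFin \o g)) => //.
- apply: indep_subsamples; rewrite cat_uniq uc filter_uniq ?enum_uniq//= andbT.
  by apply/hasPn => i; rewrite mem_filter => /andP[].
- exact/measurable_EFinP.
- by move=> y; rewrite /= lee_fin.
- exact/measurable_EFinP.
- by move=> y; rewrite /= lee_fin prodr_ge0.
Qed.

Hypothesis eqX : identically_distributed X.

Lemma subsample_law p (t u : p.-tuple 'I_n) : uniq t -> uniq u ->
  forall C, measurable C ->
  distribution P (subsample X t) C = distribution P (subsample X u) C.
Proof.
move=> ut uu; apply: box_measure_unique => [|A mA].
  by rewrite (le_lt_trans (probability_le1 _ _)) ?ltry.
rewrite /= /distribution /pushforward !subsample_box//.
by apply: eq_bigr => i _; exact: eqX.
Qed.

Lemma ge0_expectation_subsample p (t u : p.-tuple 'I_n)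
    (f : p.-tuple E -> \bar R) : uniq t -> uniq u ->
  measurable_fun [set: p.-tuple E] f -> (forall y, 0 <= f y) ->
  \int[P]_w f (subsample X t w) = \int[P]_w f (subsample X u w).
Proof.
move=> ut uu mf f0.
rewrite -[LHS](ge0_integral_distribution (subsample X t))//.
rewrite -[RHS](ge0_integral_distribution (subsample X u))//.
by apply: eq_measure_integral => C mC _; exact: subsample_law.
Qed.

End subsamples.

(** * Permutations acting on increasing tuples *)

Section increasing_tuples.
Context (n m : nat) (hmn : (m <= n)%N).
Implicit Types (t u : inc_tuple hmn) (s : {perm 'I_n}).

Lemma inc_tuple_uniq t : uniq t.
Proof.
have := inc_tupleP t; rewrite ltn_sorted_uniq_leq => /andP[+ _].
by rewrite map_inj_uniq//; exact: val_inj.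
Qed.

Lemma perm_inc_tuple_inj t u : perm_eq t u -> t = u.
Proof.
move=> tu; apply/val_inj/val_inj; apply: (inj_map val_inj).
have inc_sorted (v : inc_tuple hmn) : sorted leq (map val v).
  by have := inc_tupleP v; rewrite ltn_sorted_uniq_leq => /andP[].
apply: (sorted_eq leq_trans anti_leq (inc_sorted t) (inc_sorted u)).
by apply: perm_map.
Qed.

Definition ord_leq : rel 'I_n := fun i j => (i <= j)%N.

Lemma perm_inc_subproof s t :
  sorted ltn (map val [tuple of sort ord_leq (map_tuple s t)]).
Proof.
rewrite ltn_sorted_uniq_leq map_inj_uniq; last exact: val_inj.
rewrite sort_uniq map_inj_uniq ?inc_tuple_uniq//; last exact: perm_inj.
by rewrite sorted_map; apply: sort_sorted => i j; exact: leq_total.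
Qed.

(** Increasing tuples stand for the subsets of m indices, and this is the action
of the permutations on such subsets. *)
Definition perm_inc s t : inc_tuple hmn := IncTuple hmn (perm_inc_subproof s t).

Lemma perm_inc_perm_eq s t : perm_eq (perm_inc s t) (map s t).
Proof. by rewrite /= perm_sort. Qed.

Lemma perm_inc_inj s : injective (perm_inc s).
Proof.
move=> t u eqtu; apply: perm_inc_tuple_inj.
have : perm_eq (map s t) (map s u).
  by rewrite -(permPl (perm_inc_perm_eq s t)) eqtu perm_inc_perm_eq.
move=> /(perm_map (s^-1)%g); rewrite -!map_comp.
by rewrite !(@eq_map _ _ _ id) ?map_id// => i /=; rewrite permK.
Qed.

Lemma perm_incM s s' t : perm_inc (s * s')%g t = perm_inc s' (perm_inc s t).
Proof.
apply: perm_inc_tuple_inj.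
rewrite (permPl (perm_inc_perm_eq _ _)) perm_sym.
rewrite (permPl (perm_inc_perm_eq _ _)).
rewrite (permPl (perm_map _ (perm_inc_perm_eq _ _))) -map_comp.
by rewrite (@eq_map _ _ _ (s * s')%g) // => i /=; rewrite permM.
Qed.

Lemma perm_inc_trans t u : exists s, perm_inc s t = u.
Proof.
have in_dtuple (v : inc_tuple hmn) :
    tuple_of_inc v \in dtuple_on m [set: 'I_n]%SET.
  rewrite finset.in_set inc_tuple_uniq.
  by apply/fintype.subsetP => i _; rewrite finset.in_setT.
have tr : [transitive^m 'Sym_('I_n), on [set: 'I_n]%SET | 'P]%g.
  by apply: ntransitive_weak (Sym_trans 'I_n); rewrite card_ord.
have [s _ us] := atransP2 tr (in_dtuple t) (in_dtuple u).
exists s; apply: perm_inc_tuple_inj.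
by rewrite (permPl (perm_inc_perm_eq s t)) us.
Qed.

(** The image of t under a uniform random permutation is a uniform random
increasing tuple. By transitivity the left-hand sum is the same for all t; summing
it over t, each permutation contributes the whole sum of F because it permutes the
increasing tuples. *)
Lemma sum_perm_inc (V : nmodType) (F : inc_tuple hmn -> V) t :
  (\sum_(s : {perm 'I_n}) F (perm_inc s t)) *+ #|{: inc_tuple hmn}| =
  (\sum_u F u) *+ #|{perm 'I_n}|.
Proof.
have const u : \sum_(s : {perm 'I_n}) F (perm_inc s u) =
               \sum_(s : {perm 'I_n}) F (perm_inc s t).
  have [s0 <-] := perm_inc_trans t u.
  rewrite [RHS](reindex_inj (mulgI s0)).
  by apply: eq_bigr => s _; rewrite perm_incM.
rewrite -sumr_const -[RHS]sumr_const.
rewrite -(eq_bigr _ (fun u _ => const u)) exchange_big/=.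
by apply: eq_bigr => s _; rewrite [RHS](reindex_inj (@perm_inc_inj s)).
Qed.

Lemma block_bound (j : 'I_(n %/ m)) (i : 'I_m) : (j * m + i < n)%N.
Proof.
apply: leq_trans (leq_divM n m); apply: leq_trans (leq_mul (ltn_ord j) (leqnn m)).
by rewrite mulSn addnC ltn_add2r.
Qed.

Lemma block_subproof (j : 'I_(n %/ m)) :
  sorted ltn (map val [tuple Ordinal (block_bound j i) | i < m]).
Proof.
suff -> : map val [tuple Ordinal (block_bound j i) | i < m] = iota (j * m)%N m.
  exact: iota_ltn_sorted.
rewrite /= -map_comp -[in RHS](addn0 (j * m)%N) iotaDl -val_enum_ord -map_comp.
exact: eq_map.
Qed.

Definition block (j : 'I_(n %/ m)) : inc_tuple hmn :=
  IncTuple hmn (block_subproof j).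

Lemma mem_block j i : (i \in tuple_of_inc (block j)) = (i %/ m == j)%N.
Proof.
have m0 : (0 < m)%N.
  by case: (posnP m) j => // -> []; rewrite divn0.
apply/tnthP/eqP => [[l ->]|ij].
  by rewrite tnth_mktuple/= divnMDl// (divn_small (ltn_ord l)) addn0.
exists (Ordinal (ltn_pmod i m0)); rewrite tnth_mktuple; apply/val_inj => /=.
by rewrite -ij -divn_eq.
Qed.

Lemma perm_block_disjoint s j l : j != l ->
  forall i, i \in tuple_of_inc (perm_inc s (block j)) ->
    i \notin tuple_of_inc (perm_inc s (block l)).
Proof.
move=> jl i; rewrite !(perm_mem (perm_inc_perm_eq _ _)).
rewrite -(permKV s i) !mem_map; try exact: perm_inj.
by rewrite !mem_block => /eqP ->.
Qed.

End increasing_tuples.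

(** * Moment generating functions of the two errors *)

Section U_statistics.
Context d (T : measurableType d) (R : realType) (P : probability T R).
Context d' (E : measurableType d') (m n : nat) (hmn : (m <= n)%N).
Variables (X : 'I_n -> {RV P >-> E}) (h : m.-tuple E -> R) (a r : R).
Hypothesis iidX : iid X.
Hypothesis mh : measurable_fun [set: m.-tuple E] h.
Hypothesis hr : forall x, h x \in `[a, a + r].

Definition complete_U_statistic (w : T) : R :=
  #|{: inc_tuple hmn}|%:R^-1 *
    \sum_(t : inc_tuple hmn) h (subsample X t w).

Local Notation U := complete_U_statistic.
Local Notation mean_h := (kernel_mean hmn h X).

Lemma card_inc_tuple_gt0 : (0 < #|{: inc_tuple hmn}|)%N.
Proof. by apply/card_gt0P; exists point. Qed.

Lemma measurable_kernel_subsample (t : m.-tuple 'I_n) :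
  measurable_fun [set: T] (fun w => h (subsample X t w)).
Proof. by apply: measurableT_comp => //; exact: measurable_subsample. Qed.

Lemma measurable_complete_U_statistic : measurable_fun [set: T] U.
Proof.
apply: measurable_funM => //; apply: measurable_sum => t.
exact: measurable_kernel_subsample.
Qed.

Lemma mgf_kernel (t : m.-tuple 'I_n) (s : R) : uniq t ->
  (\int[P]_w (expR (s * (h (subsample X t w) - mean_h)))%:E <=
   (expR (s ^+ 2 * r ^+ 2 / 8))%:E)%E.
Proof.
move=> ut; have [_ eqX] := iidX.
pose t0 := first_indices hmn.
have ut0 : uniq t0 by exact: (inc_tuple_uniq (IncTuple hmn (first_indicesP hmn))).
pose f y := (expR (s * (h y - mean_h)))%:E.
have mf : measurable_fun [set: m.-tuple E] f.
  apply/measurable_EFinP; apply: measurableT_comp => //.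
  by apply: measurable_funM => //; exact: measurable_funB.
rewrite (ge0_expectation_subsample (proj1 iidX) eqX ut ut0 mf) => [|y]; last first.
  by rewrite lee_fin expR_ge0.
pose Z : {RV P >-> R} := HB.pack (fun w => h (subsample X t0 w))
  (isMeasurableFun.Build _ _ _ _ _ (measurable_kernel_subsample t0)).
have Zar w : Z w \in `[a, a + r] by exact: hr.
have := hoeffding_lemma s Zar; apply: le_trans.
rewrite (_ : fine _ = mean_h)// /mmt_gen_fun unlock.
rewrite le_eqVlt; apply/orP; left; apply/eqP.
by apply: eq_integral => w _; rewrite /f /= mulrC.
Qed.

(** Hoeffding's averaging over permutations: U is the mean over p of the block
averages W p. The k terms of each W p involve disjoint sets of variables, so that
its moment generating function factorizes. *)
Lemma mgf_complete_U_statistic (s : R) : (0 < m)%N ->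
  ('M_P (fun w => U w - mean_h)%R s <=
   (expR (s ^+ 2 * (r ^+ 2 / (8 * (n %/ m)%:R))))%:E)%E.
Proof.
move=> m0; set k := (n %/ m)%N; have k0 : (0 < k)%N by rewrite divn_gt0.
pose H (t : inc_tuple hmn) w := h (subsample X (tuple_of_inc t) w).
pose c (p : {perm 'I_n}) (j : 'I_k) := perm_inc p (block hmn j).
pose W p w := k%:R^-1 * \sum_j H (c p j) w.
have cardS : (0 < #|{perm 'I_n}|)%N by apply/card_gt0P; exists 1%g.
have cardS0 : #|{perm 'I_n}|%:R != 0 :> R by rewrite pnatr_eq0 -lt0n.
have UE w : U w = #|{perm 'I_n}|%:R^-1 * \sum_p W p w.
  have inc0 : #|{: inc_tuple hmn}|%:R != 0 :> R.
    by rewrite pnatr_eq0 -lt0n card_inc_tuple_gt0.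
  have avg j : \sum_p H (c p j) w = #|{perm 'I_n}|%:R * U w.
    apply: (mulIf inc0); rewrite mulr_natr.
    rewrite [LHS](sum_perm_inc (H^~ w) (block hmn j)) -mulr_natr.
    by rewrite /U; field.
  rewrite /W -mulr_sumr exchange_big/=.
  under eq_bigr do rewrite avg.
  rewrite sumr_const card_ord -mulr_natr; field.
  by apply/andP; split => //; rewrite pnatr_eq0 -lt0n.
pose g p w := \prod_(j < k) expR (s / k%:R * (H (c p j) w - mean_h)).
have gE p w : g p w = expR (s * (W p w - mean_h)).
  by have := @expR_mean_prod R 'I_k (fun j => H (c p j) w) s mean_h;
     rewrite card_ord => ->.
have mg p : measurable_fun [set: T] (g p).
  apply: measurable_prod => j _; apply: measurableT_comp => //.
  apply: measurable_funM => //; apply: measurable_funB => //.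
  exact: measurable_kernel_subsample.
have g0 p w : 0 <= g p w by rewrite gE expR_ge0.
have pointwise w :
    expR (s * (U w - mean_h)) <= #|{perm 'I_n}|%:R^-1 * \sum_p g p w.
  under eq_bigr do rewrite gE.
  apply: le_trans (expR_mean_le _ cardS).
  rewrite ler_expR -mulr_sumr sumrB sumr_const -[mean_h *+ _]mulr_natr UE.
  by rewrite le_eqVlt; apply/orP; left; apply/eqP; field.
have int_g p : (\int[P]_w (g p w)%:E <=
    (expR (s ^+ 2 * (r ^+ 2 / (8 * k%:R))))%:E)%E.
  rewrite /g /H (@ge0_expectation_prod_blocks _ _ _ _ _ _ _ _ (proj1 iidX) _ _
    (fun j => tuple_of_inc (c p j))
    (fun _ y => expR (s / k%:R * (h y - mean_h)))).
  - rewrite -expR_sqr_expn//; set e := expR _.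
    rewrite (_ : e ^+ k = \prod_(j < k) e); last first.
      by rewrite prodr_const card_ord.
    rewrite -prodEFin.
    apply: lee_prod => j.
    apply/andP; split; last by apply: mgf_kernel; exact: inc_tuple_uniq.
    by apply: integral_ge0 => w _; rewrite lee_fin expR_ge0.
  - by move=> j; exact: inc_tuple_uniq.
  - by move=> j l jl; exact: perm_block_disjoint.
  - move=> j; apply: measurableT_comp => //.
    by apply: measurable_funM => //; exact: measurable_funB.
  - by move=> j y; exact: expR_ge0.
rewrite /mmt_gen_fun unlock.
apply: (@le_trans _ _ (\int[P]_w (#|{perm 'I_n}|%:R^-1 * \sum_p g p w)%:E)%E).
  apply: ge0_le_integral => //.
  - by move=> w _; rewrite lee_fin expR_ge0.
  - apply/measurable_EFinP; apply: measurableT_comp => //=.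
    apply: measurable_funM => //; apply: measurable_funB => //.
    exact: measurable_complete_U_statistic.
  - apply/measurable_EFinP; apply: measurable_funM => //.
    exact: measurable_sum.
  - by move=> w _; rewrite lee_fin /= mulrC.
rewrite ge0_expectation_mean//.
apply: (le_trans (lee_sum _ (fun p _ => lee_wpmul2l _ (int_g p)))).
  by rewrite lee_fin invr_ge0.
rewrite sumEFin lee_fin sumr_const; set e := expR _.
by rewrite -mulrnAl -[_^-1 *+ _]mulr_natr mulVf// mul1r.
Qed.

Section incomplete.
Variables (B : nat) (I : 'I_B -> {RV P >-> inc_tuple hmn}).
Hypothesis B0 : (0 < B)%N.
Hypothesis indI : mutually_independent I.
Hypothesis unifI : forall b, uniformly_distributed (I b).
Hypothesis indXI : independent_families X I.

Local Notation UB := (incomplete_U_statistic h X I).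

(** The selected tuple is random, but it takes finitely many values, so each term
is a finite sum of measurable functions cut by indicators. *)
Lemma measurable_incomplete_U_statistic : measurable_fun [set: T] UB.
Proof.
apply: measurable_funM => //; apply: measurable_sum => b.
rewrite (_ : (fun w => _) = fun w => \sum_(t : inc_tuple hmn)
    \1_(I b @^-1` [set t]) w * h (subsample X t w)).
  apply: measurable_sum => t; apply: measurable_funM.
    by apply: measurable_indic; exact: measurable_funPTI.
  exact: measurable_kernel_subsample.
apply/funext => w; rewrite (bigD1 (I b w))//= big1 => [|t tI].
  by rewrite indicE mem_set// mul1r addr0.
by rewrite indicE memNset ?mul0r// => /= Ibt; rewrite Ibt eqxx in tI.
Qed.

Lemma measurable_indices (f : {ffun 'I_B -> inc_tuple hmn}) :
  measurable [set w | forall b, I b w = f b].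
Proof.
rewrite (_ : mkset _ = \bigcap_(b in [set: 'I_B]) I b @^-1` [set f b]).
  by apply: fin_bigcap_measurable => // b _; exact: measurable_funPTI.
by apply/seteqP; split => w /= If b => [_|]; apply: If.
Qed.

Lemma uniform_indices (f : {ffun 'I_B -> inc_tuple hmn}) :
  P [set w | forall b, I b w = f b] =
  (#|{: {ffun 'I_B -> inc_tuple hmn}}|%:R^-1)%:E.
Proof.
have := @indI [set: 'I_B]%SET (fun b => [set f b]) (fun b _ => Logic.I).
rewrite (eq_bigr (fun=> (#|{: inc_tuple hmn}|%:R^-1)%:E)); last first.
  by move=> b _; exact: unifI.
rewrite prodEFin prodr_const cardsT card_ord exprVn -natrX => H.
rewrite card_ffun card_ord -H.
congr (P _); apply/seteqP; split => w /= If b => [_|]; apply: If => //=.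
by rewrite finset.in_setT.
Qed.

(** The event that the drawn tuples are f is independent of the data, of which
g is a function through the full sample. *)
Lemma expectation_on_indices (f : {ffun 'I_B -> inc_tuple hmn})
    (g : n.-tuple E -> R) :
  measurable_fun [set: n.-tuple E] g -> (forall y, 0 <= g y) ->
  (\int[P]_w (\1_[set w | forall b, I b w = f b] w *
              g (subsample X (ord_tuple n) w))%:E =
   (#|{: {ffun 'I_B -> inc_tuple hmn}}|%:R^-1)%:E *
     \int[P]_w (g (subsample X (ord_tuple n) w))%:E)%E.
Proof.
move=> mg g0.
pose J w : B.-tuple (inc_tuple hmn) := [tuple I b w | b < B].
have mJ : measurable_fun [set: T] J.
  apply/measurable_fun_tnthP => b; rewrite (_ : _ \o _ = I b)//.
  by apply/funext => w; rewrite /= tnth_mktuple.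
pose JM : {mfun T >-> B.-tuple (inc_tuple hmn)} :=
  HB.pack J (isMeasurableFun.Build _ _ _ _ J mJ).
pose bf : set (B.-tuple (inc_tuple hmn)) := box (fun b => [set f b]).
have mbf : measurable bf by exact: measurable_box.
have JbfE : J @^-1` bf = [set w | forall b, I b w = f b].
  by apply/seteqP; split => w /= If b; have := If b; rewrite /= tnth_mktuple.
have mA := measurable_indices f.
have indep : forall A C, measurable A -> measurable C ->
    (P (JM @^-1` A `&` subsample X (ord_tuple n) @^-1` C) =
     P (JM @^-1` A) * P (subsample X (ord_tuple n) @^-1` C))%E.
  move=> A C sA sC; rewrite setIC muleC; apply: indXI.
    rewrite (_ : (fun i => X i : T -> E) =
        (fun i => (@tnth n E)^~ i \o subsample X (ord_tuple n))); last first.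
      apply/funext => i; apply/funext => w /=.
      by rewrite tnth_mktuple tnth_ord_tuple.
    by rewrite g_sigma_preimage_comp; exists C => //; rewrite setTI.
  rewrite (_ : (fun j => I j : T -> inc_tuple hmn) =
      (fun j => (@tnth B (inc_tuple hmn))^~ j \o J)); last first.
    by apply/funext => j; apply/funext => w /=; rewrite tnth_mktuple.
  by rewrite g_sigma_preimage_comp; exists A => //; rewrite setTI.
have PJ : (\int[P]_w (EFin \o \1_bf) (JM w) =
    (#|{: {ffun 'I_B -> inc_tuple hmn}}|%:R^-1)%:E)%E.
  rewrite -(uniform_indices f) -[in RHS](setIT [set w | _]) -integral_indic//.
  by apply: eq_integral => w _; rewrite /= -JbfE.
rewrite -PJ.
rewrite -(@ge0_expectation_prod _ _ _ P _ _ _ _ JM (subsample X (ord_tuple n))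
  (EFin \o \1_bf) (EFin \o g) indep)//.
- apply: eq_integral => w _; rewrite /= -EFinM; congr (_ * _)%:E.
  by rewrite -JbfE.
- by apply/measurable_EFinP; exact: measurable_indic.
- by move=> y; rewrite /= lee_fin.
- exact/measurable_EFinP.
Qed.

(** Summing over the values f of the drawn tuples replaces the drawing by its
average over all f. That average of products over the draws is a product of B
equal averages over the increasing tuples, each bounded by Hoeffding's lemma for
the population of the values of h on the data. *)
Lemma mgf_incomplete_U_statistic (s : R) :
  ('M_P (fun w => UB w - U w)%R s <=
   (expR (s ^+ 2 * (r ^+ 2 / (8 * B%:R))))%:E)%E.
Proof.
(* kernel values and complete U-statistic as functions of the full sample y *)
pose F := {ffun 'I_B -> inc_tuple hmn}.
pose Hy (t : inc_tuple hmn) (y : n.-tuple E) : R :=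
  h [tuple tnth y (tnth t i) | i < m].
pose Uy y := #|{: inc_tuple hmn}|%:R^-1 * \sum_(t : inc_tuple hmn) Hy t y.
pose Y w : n.-tuple E := subsample X (ord_tuple n) w.
have HyE t w : Hy t (Y w) = h (subsample X t w).
  congr h; apply: eq_from_tnth => i.
  by rewrite !tnth_mktuple tnth_ord_tuple.
have UyE w : Uy (Y w) = U w.
  by congr (_ * _); apply: eq_bigr => t _; exact: HyE.
pose g (f : F) y := \prod_(b < B) expR (s / B%:R * (Hy (f b) y - Uy y)).
have mHy t : measurable_fun [set: n.-tuple E] (Hy t).
  apply: measurableT_comp => //; apply/measurable_fun_tnthP => i.
  rewrite (_ : _ \o _ = (@tnth n E)^~ (tnth t i)); first exact: measurable_tnth.
  by apply/funext => y; rewrite /= tnth_mktuple.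
have mg f : measurable_fun [set: n.-tuple E] (g f).
  apply: measurable_prod => b _; apply: measurableT_comp => //.
  apply: measurable_funM => //; apply: measurable_funB => //.
  by apply: measurable_funM => //; exact: measurable_sum.
have g0 f y : 0 <= g f y by apply: prodr_ge0 => b _; exact: expR_ge0.
have mgY f : measurable_fun [set: T] (fun w => g f (Y w)).
  by apply: measurableT_comp => //; exact: measurable_subsample.
have mean_g y : #|{: F}|%:R^-1 * \sum_f g f y <=
    expR (s ^+ 2 * (r ^+ 2 / (8 * B%:R))).
  rewrite /g -(bigA_distr_bigA (fun _ t => expR (s / B%:R * (Hy t y - Uy y)))).
  rewrite prodr_const card_ffun card_ord natrX -exprVn -exprMn -expR_sqr_expn//.
  apply: lerXn2r; rewrite ?nnegrE ?expR_ge0//.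
    by rewrite mulr_ge0 ?invr_ge0// sumr_ge0// => t _; exact: expR_ge0.
  apply: mean_expR_le; first exact: card_inc_tuple_gt0.
  by move=> t; exact: hr.
have expE w : expR (s * (UB w - U w)) =
    \sum_(f : F) \1_[set w | forall b, I b w = f b] w * g f (Y w).
  pose f0 : F := [ffun b => I b w].
  rewrite (bigD1 f0)//= big1 => [|f fI].
    rewrite indicE mem_set/= ?mul1r ?addr0; last by move=> b; rewrite ffunE.
    have := @expR_mean_prod R 'I_B (fun b => h (subsample X (I b w) w)) s (U w).
    rewrite card_ord => -> //; apply: eq_bigr => b _.
    by rewrite ffunE HyE UyE.
  rewrite indicE memNset ?mul0r//= => If; move/eqP: fI; apply.
  by apply/ffunP => b; rewrite ffunE.
rewrite /mmt_gen_fun unlock.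
have -> : (\int[P]_w ((expR \o s \o* (fun w => UB w - U w)) w)%:E =
    \int[P]_w (#|{: F}|%:R^-1 * \sum_(f : F) g f (Y w))%:E)%E.
  rewrite ge0_expectation_mean//.
  under eq_integral do rewrite /= mulrC expE -sumEFin.
  rewrite ge0_integral_sum//.
  - by apply: eq_bigr => f _; exact: expectation_on_indices.
  - move=> f; apply/measurable_EFinP; apply: measurable_funM => //.
    by apply: measurable_indic; exact: measurable_indices.
  - by move=> f w _; rewrite lee_fin mulr_ge0.
apply: (@le_trans _ _ (\int[P]_w (expR (s ^+ 2 * (r ^+ 2 / (8 * B%:R))))%:E)%E).
  apply: ge0_le_integral => //.
  - by move=> w _; rewrite lee_fin mulr_ge0 ?invr_ge0// sumr_ge0.
  - apply/measurable_EFinP; apply: measurable_funM => //.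
    exact: measurable_sum.
  - by move=> w _; rewrite lee_fin.
rewrite integral_cst//; have := probability_setT P => /= ->.
by rewrite mule1.
Qed.

End incomplete.

End U_statistics.

(** * Concentration of the incomplete U-statistic *)

Theorem proposition5p6
  (R : realType) (d : measure_display) (T : measurableType d)
  (P : probability T R)
  (d' : measure_display) (E : measurableType d')
  (m n B : nat) (hm : (2 <= m)%N) (hmn : (m <= n)%N) (hB : (1 <= B)%N)
  (X : 'I_n -> {RV P >-> E}) (iidX : iid X)
  (I : 'I_B -> {RV P >-> inc_tuple hmn})
  (indI : mutually_independent I)
  (unifI : forall b : 'I_B, uniformly_distributed (I b))
  (indXI : independent_families X I)
  (h : m.-tuple E -> R) (mh : measurable_fun [set: m.-tuple E] h)
  (a r : R) (hr : forall x : m.-tuple E, h x \in `[a, a + r]%R)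
  (delta : R) (delta01 : 0 < delta < 1) :
  let k := (n %/ m)%N in
  ((1 - delta)%:E <=
    P [set w | (`|incomplete_U_statistic h X I w - kernel_mean hmn h X| <=
                r * Num.sqrt (ln (4 / delta) / (2 * k%:R)) +
                r * Num.sqrt (ln (4 / delta) / (2 * B%:R)))%R])%E.
Proof.
cbv zeta; set k := (n %/ m)%N; have /andP[delta0 delta1] := delta01.
have m0 : (0 < m)%N by exact: ltnW.
have k0 : (0 < k)%N by rewrite divn_gt0.
pose L := ln (4 / delta).
have L0 : 0 < L by apply: ln_gt0; rewrite ltr_pdivlMr//; lra.
have expL : expR (- L) = delta / 4.
  by rewrite expRN lnK ?invf_div// posrE divr_gt0.
pose t1 := r * Num.sqrt (L / (2 * k%:R)).
pose t2 := r * Num.sqrt (L / (2 * B%:R)).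
pose UB := incomplete_U_statistic h X I; pose mu := kernel_mean hmn h X.
rewrite -/L -/t1 -/t2 -/UB -/mu.
set D := mkset _.
pose U := complete_U_statistic hmn X h.
have mUB : measurable_fun [set: T] UB.
  by apply: measurable_incomplete_U_statistic.
have mU : measurable_fun [set: T] U by exact: measurable_complete_U_statistic.
have mZ : measurable_fun [set: T] (fun w => UB w - mu) by exact: measurable_funB.
have mZ1 : measurable_fun [set: T] (fun w => U w - mu) by exact: measurable_funB.
have mZ2 : measurable_fun [set: T] (fun w => UB w - U w) by exact: measurable_funB.
have r0 : 0 <= r.
  by have := hr [tuple point | i < m]; rewrite in_itv/= => /andP[]; lra.
have mle (f : T -> R) t : measurable_fun [set: T] f ->
    measurable [set w | t <= `|f w|].
  move=> mf; rewrite (_ : mkset _ = (fun w => `|f w|) @^-1` `[t, +oo[).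
    by rewrite -[X in measurable X]setTI; apply: measurableT_comp.
  by apply/seteqP; split => w /=; rewrite in_itv/= andbT.
have mD : measurable D.
  rewrite (_ : D = (fun w => `|UB w - mu|) @^-1` `]-oo, t1 + t2]).
    by rewrite -[X in measurable X]setTI; apply: measurableT_comp.
  by apply/seteqP; split => w /=; rewrite in_itv.
(* Chernoff's bound needs a positive variance proxy; if r = 0 then h is constant *)
have [r_eq0|r_neq0] := eqVneq r 0.
  have ha x : h x = a.
    by have := hr x; rewrite r_eq0 addr0 in_itv/= => /andP[]; lra.
  have UBa w : UB w = a.
    rewrite /UB /incomplete_U_statistic; under eq_bigr do rewrite ha.
    rewrite sumr_const card_ord -[a *+ _]mulr_natl mulrA mulVf ?mul1r//.
    by rewrite pnatr_eq0 -lt0n.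
  have mua : mu = a.
    rewrite /mu /kernel_mean (_ : (fun w => _) = cst a) ?expectation_cst//.
    by apply/funext => w; exact: ha.
  have -> : D = setT.
    apply/seteqP; split => // w _.
    by rewrite /D/= UBa mua subrr normr0 addr_ge0// mulr_ge0// sqrtr_ge0.
  by have := probability_setT P => /= ->; rewrite lee_fin; lra.
have r_gt0 : 0 < r by rewrite lt_neqAle eq_sym r_neq0.
have tail (Z : T -> R) (mZ' : measurable_fun [set: T] Z) N : (0 < N)%N ->
    (forall s, 'M_P Z s <= (expR (s ^+ 2 * (r ^+ 2 / (8 * N%:R))))%:E)%E ->
    (P [set w | r * Num.sqrt (L / (2 * N%:R)) <= `|Z w|]%R <=
      (delta / 2)%:E)%E.
  move=> N0 MZ; have N0' : 0 < N%:R :> R by rewrite ltr0n.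
  pose ZM : {RV P >-> R} := HB.pack Z (isMeasurableFun.Build _ _ _ _ Z mZ').
  have v0 : 0 < r ^+ 2 / (8 * N%:R) by rewrite divr_gt0 ?exprn_gt0 ?mulr_gt0.
  have LN0 : 0 < L / (2 * N%:R) by rewrite divr_gt0 ?mulr_gt0.
  have t0 : 0 < r * Num.sqrt (L / (2 * N%:R)) by rewrite mulr_gt0 ?sqrtr_gt0.
  have := @subgaussian_tail _ _ _ P ZM _ _ v0 t0 MZ.
  have -> : (r * Num.sqrt (L / (2 * N%:R))) ^+ 2 /
      (4 * (r ^+ 2 / (8 * N%:R))) = L.
    rewrite exprMn sqr_sqrtr ?ltW//; field.
    by rewrite r_neq0 lt0r_neq0.
  by rewrite expL (_ : 2 * (delta / 4) = delta / 2)//; field.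
have PDC : (P (~` D) <= delta%:E)%E.
  rewrite [X in (_ <= X%:E)%E](splitr delta) EFinD.
  apply: (@le_trans _ _ (P [set w | t1 <= `|U w - mu|]%R +
                         P [set w | t2 <= `|UB w - U w|]%R)%E); last first.
    apply: leeD; apply: tail => // s.
      exact: mgf_complete_U_statistic.
    exact: mgf_incomplete_U_statistic.
  apply: le_trans (measureU2 _ _ _); [|exact: mle..].
  apply: le_measure.
  - by apply/mem_set; exact: measurableC.
  - by apply/mem_set; apply: measurableU; exact: mle.
  - move=> w /= /negP; rewrite -ltNge => tD.
    have [U1|U1] := leP t1 `|U w - mu|; [by left|right].
    have := ler_normD (UB w - U w) (U w - mu).
    by rewrite addrA subrK => /(lt_le_trans tD); lra.
rewrite probability_setC// in PDC.
move: PDC; rewrite leeBlDr ?fin_num_measure// => PDC.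
by rewrite EFinB leeBlDr// addeC.
Qed.
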